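(* Let the source $\vec{M}$ be a zero-mean $n$-dimensional Gaussian random variable with covariance matrix $\Sigma_{\vec{M}}=\mathrm{diag}\{\sigma_{m_1}^2,\ldots,\sigma_{m_n}^2\}$, and let the noise $\vec{W}$, independent of $\vec{M}$, be a zero-mean $n$-dimensional Gaussian random variable with covariance matrix $\Sigma_{\vec{W}}=\mathrm{diag}\{\sigma_{w_1}^2,\ldots,\sigma_{w_n}^2\}$ (all variances positive). Consider the signaling game with encoder cost $\|\vec{m}-\vec{u}-\vec{b}\|^2+\lambda\|\vec{x}\|^2$ and decoder cost $\|\vec{m}-\vec{u}\|^2$, with $\vec{b}\in\mathbb{R}^n$ and $\lambda>0$. Then an informative affine Nash equilibrium exists if $$\lambda<\max\left\{\frac{\sigma_{m_1}^2}{\sigma_{w_1}^2},\ldots,\frac{\sigma_{m_n}^2}{\sigma_{w_n}^2}\right\}.$$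
   Context: The encoder observes $\vec{m}\in\mathbb{R}^n$ and sends $\vec{x}=\gamma^e(\vec{m})\in\mathbb{R}^n$; the decoder receives $\vec{y}=\vec{x}+\vec{w}$ and chooses $\vec{u}=\gamma^d(\vec{y})\in\mathbb{R}^n$; policies are measurable functions. The costs to be minimized are $J^e(\gamma^e,\gamma^d)=\mathbb{E}[\|\vec{m}-\vec{u}-\vec{b}\|^2+\lambda\|\vec{x}\|^2]$ for the encoder and $J^d(\gamma^e,\gamma^d)=\mathbb{E}[\|\vec{m}-\vec{u}\|^2]$ for the decoder, with Euclidean norms. A pair $(\gamma^{*,e},\gamma^{*,d})$ is a Nash equilibrium if $J^e(\gamma^{*,e},\gamma^{*,d})\le J^e(\gamma^e,\gamma^{*,d})$ for all $\gamma^e$ and $J^d(\gamma^{*,e},\gamma^{*,d})\le J^d(\gamma^{*,e},\gamma^d)$ for all $\gamma^d$. It is affine if $\gamma^e(\vec{m})=A\vec{m}+\vec{C}$ and $\gamma^d(\vec{y})=K\vec{y}+\vec{L}$, and an affine equilibrium is informative if $A\neq0$ (i.e., the transmitted signal is not statistically independent of the source). *)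

(* Defs.v *)
From HB Require Import structures.
From mathcomp Require Import all_boot all_order all_algebra.
From mathcomp Require Import all_classical all_reals all_analysis.

Set Implicit Arguments.
Unset Strict Implicit.
Unset Printing Implicit Defensive.

Import Order.TTheory GRing.Theory Num.Theory.
Import numFieldNormedType.Exports.

Local Open Scope classical_set_scope.
Local Open Scope ring_scope.

(* The vectors of R^n are the column vectors 'cV[R]_n. Their sigma-algebra is
   generated by the coordinate maps, as the library does for n.-tuple R; for
   R : realType it is the Borel sigma-algebra of R^n. *)
Definition cV_measurable d (T : measurableType d) (n : nat) :
    set (set 'cV[T]_n) :=
  g_sigma_preimage (fun (i : 'I_n) (v : 'cV[T]_n) => v i ord0).

Lemma cV_measurable0 d (T : measurableType d) n : @cV_measurable d T n set0.
Proof. exact: sigma_algebra0. Qed.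

Lemma cV_measurableC d (T : measurableType d) n (A : set 'cV[T]_n) :
  cV_measurable A -> cV_measurable (~` A).
Proof. exact: sigma_algebraC. Qed.

Lemma cV_measurable_bigcup d (T : measurableType d) n
    (F : (set 'cV[T]_n)^nat) :
  (forall i, cV_measurable (F i)) -> cV_measurable (\bigcup_i F i).
Proof. exact: sigma_algebra_bigcup. Qed.

Definition cV_display : measure_display -> measure_display.
Proof. exact. Qed.

HB.instance Definition _ d (T : measurableType d) (n : nat) :=
  @isMeasurable.Build (cV_display d) 'cV[T]_n (@cV_measurable d T n)
    (@cV_measurable0 d T n) (@cV_measurableC d T n)
    (@cV_measurable_bigcup d T n).

(* The integral of f over R^n with respect to the n-dimensional Lebesgue
   measure, as an iterated one-dimensional integral. By Tonelli the two agree
   for f nonnegative and Borel, the only case used below. *)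
Fixpoint integral_cV (R : realType) (n : nat) :
    ('cV[R]_n -> \bar R) -> \bar R :=
  match n with
  | 0 => fun f => f 0
  | n'.+1 => fun f : 'cV[R]_(1 + n') -> \bar R =>
      (\int[lebesgue_measure]_(x in [set: R])
         integral_cV (fun v : 'cV[R]_n' =>
           f (col_mx (const_mx x : 'cV[R]_1) v)))%E
  end.

Definition gaussian_pdf (R : realType) (n : nat) (mu : 'cV[R]_n)
    (Sigma : 'M[R]_n) (x : 'cV[R]_n) : R :=
  (Num.sqrt ((2 * pi) ^+ n * \det Sigma))^-1 *
  expR (- ((x - mu)^T *m invmx Sigma *m (x - mu)) ord0 ord0 / 2).

(* X is a Gaussian random vector with mean mu and (positive definite)
   covariance matrix Sigma. *)
Definition gaussian_vector d (T : measurableType d) (R : realType)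
    (P : probability T R) (n : nat) (X : {RV P >-> 'cV[R]_n})
    (mu : 'cV[R]_n) (Sigma : 'M[R]_n) : Prop :=
  [/\ Sigma^T = Sigma,
      forall v : 'cV[R]_n, v != 0 -> 0 < (v^T *m Sigma *m v) ord0 ord0
    & forall B : set 'cV[R]_n, measurable B ->
        P (X @^-1` B) =
        integral_cV (fun x => (gaussian_pdf mu Sigma x * \1_B x)%:E)].

Definition independent_RV d d1 d2 (T : measurableType d)
    (T1 : measurableType d1) (T2 : measurableType d2) (R : realType)
    (P : probability T R) (X : {RV P >-> T1}) (Y : {RV P >-> T2}) : Prop :=
  forall (A : set T1) (B : set T2), measurable A -> measurable B ->
    P ((X @^-1` A) `&` (Y @^-1` B)) = (P (X @^-1` A) * P (Y @^-1` B))%E.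

(* The square of the Euclidean norm; the library's norm on matrices is the
   max norm. *)
Definition sqnorm (R : realType) (n : nat) (v : 'cV[R]_n) : R :=
  \sum_(i < n) v i ord0 ^+ 2.

(* Costs are extended real numbers: the integrands are nonnegative and
   measurable, so the expectations are always defined, possibly +oo. *)
Definition encoder_cost d (T : measurableType d) (R : realType)
    (P : probability T R) (n : nat) (M W : {RV P >-> 'cV[R]_n})
    (b : 'cV[R]_n) (lambda : R)
    (ge gd : {mfun 'cV[R]_n >-> 'cV[R]_n}) : \bar R :=
  ('E_P[(fun omega : T =>
     let m := M omega in
     let x := ge m in
     let y := x + W omega in
     let u := gd y in
     sqnorm (m - u - b) + lambda * sqnorm x)%R])%E.

Definition decoder_cost d (T : measurableType d) (R : realType)
    (P : probability T R) (n : nat) (M W : {RV P >-> 'cV[R]_n})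
    (ge gd : {mfun 'cV[R]_n >-> 'cV[R]_n}) : \bar R :=
  ('E_P[(fun omega : T =>
     let m := M omega in
     let x := ge m in
     let y := x + W omega in
     let u := gd y in
     sqnorm (m - u))%R])%E.

Definition nash_equilibrium d (T : measurableType d) (R : realType)
    (P : probability T R) (n : nat) (M W : {RV P >-> 'cV[R]_n})
    (b : 'cV[R]_n) (lambda : R)
    (ge gd : {mfun 'cV[R]_n >-> 'cV[R]_n}) : Prop :=
  (forall ge' : {mfun 'cV[R]_n >-> 'cV[R]_n},
     (encoder_cost M W b lambda ge gd <= encoder_cost M W b lambda ge' gd)%E) /\
  (forall gd' : {mfun 'cV[R]_n >-> 'cV[R]_n},
     (decoder_cost M W ge gd <= decoder_cost M W ge gd')%E).

Definition informative_affine (R : realType) (n : nat)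
    (ge gd : 'cV[R]_n -> 'cV[R]_n) : Prop :=
  exists (A K : 'M[R]_n) (C L : 'cV[R]_n),
    [/\ forall m, ge m = A *m m + C,
        forall y, gd y = K *m y + L
      & A != 0].

(* Main.v *)
(* Only coordinate k, one with lambda < sigma_m k ^ 2 / sigma_w k ^ 2, carries
   information: x_k and u_k are affine functions of m_k and y_k, and all other
   coordinates of x and u vanish. Both best-response properties come from
   symmetries of the joint law of (M, W): if S preserves this law and
   F + F o S <= G + G o S pointwise, then E F <= E G for nonnegative F and G.
   For the encoder S is w_i |-> - w_i; for the decoder it is the reflection of
   (m_i, w_i) that fixes y_i and exchanges m_i with its mirror image through
   the estimate u_i. *)
Require Import Defs.
From HB Require Import structures.
From mathcomp Require Import all_boot all_order all_algebra.
From mathcomp Require Import all_classical all_reals all_analysis.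
From mathcomp Require Import measurable_realfun ring.

Import Order.TTheory GRing.Theory Num.Theory.
Import numFieldNormedType.Exports.

Local Open Scope classical_set_scope.
Local Open Scope ring_scope.

(** * Translations and sign change in one-dimensional Lebesgue integrals *)

Section affine_change.
Context {R : realType}.
Local Notation mu := (@lebesgue_measure R).

Lemma lebesgue_measure_shift (c : R) (A : set R) : measurable A ->
  pushforward mu (+%R c : _ -> measurableTypeR R) A = mu A.
Proof.
move=> mA; apply/esym/lebesgue_measure_unique => //=.
  exact: measurable_funD.
move=> _ _ [[a b]] _ <-.
rewrite /pushforward.
have -> : +%R c @^-1` `]a, b] = `]a - c, b - c]%classic.
  by apply/seteqP; split => x /=; rewrite !in_itv/= ltrBlDl lerBrDl.
rewrite !lebesgue_measure_itv/= !lte_fin ltrD2r.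
by rewrite -!EFinB opprB addrA subrK.
Qed.

Lemma ge0_integral_shift (c : R) (f : R -> \bar R) :
  measurable_fun setT f -> (forall x, (0 <= f x)%E) ->
  (\int[mu]_x f (c + x)%R = \int[mu]_x f x)%E.
Proof.
move=> mf f0.
have mc : measurable_fun setT (+%R c : measurableTypeR R -> measurableTypeR R).
  exact: measurable_funD.
transitivity (\int[pushforward mu (+%R c : _ -> measurableTypeR R)]_x f x)%E.
  by rewrite (ge0_integral_pushforward mc).
by apply: eq_measure_integral => //= A mA _; exact: lebesgue_measure_shift.
Qed.

Lemma ge0_integral_opp (f : R -> \bar R) :
  measurable_fun setT f -> (forall x, (0 <= f x)%E) ->
  (\int[mu]_x f (- x)%R = \int[mu]_x f x)%E.
Proof.
move=> mf f0.
transitivity (\int[pushforward mu (-%R : _ -> measurableTypeR R)]_x f x)%E.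
  by rewrite ge0_integral_pushforward.
by apply: eq_measure_integral => //= A mA _; exact: lebesgue_measureN.
Qed.

End affine_change.

(** * The reflection preserves planar Lebesgue integrals *)

Section measure_preserving_reflection.
Context {R : realType}.
Implicit Types a k s t : R.

(* The involution fixing y = a * m + w and negating m - k * y. *)
Definition reflection a k (z : R * R) : R * R :=
  let y := a * z.1 + z.2 in
  let m := 2 * k * y - z.1 in (m, y - a * m).

Lemma measurable_reflection a k : measurable_fun setT (reflection a k).
Proof.
have mf1 : measurable_fun setT (fun z : R * R => 2 * k * (a * z.1 + z.2) - z.1).
  apply: measurable_funB => //; apply: measurable_funM => //.
  by apply: measurable_funD => //; apply: measurable_funM.
apply: measurable_fun_pair => //=.
apply: measurable_funB; last exact: measurable_funM.
by apply: measurable_funD => //; apply: measurable_funM.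
Qed.

(** In the coordinates (m, y) with y = a m + w, the reflection is m |-> 2 k y - m at fixed y. It is
    thus a shear, a flip and a shear back, each a translation or sign change in one variable;
    Tonelli brings that variable to the inner integral. *)
Lemma ge0_integral_reflection a k (g : R * R -> \bar R) :
  measurable_fun setT g -> (forall z, (0 <= g z)%E) ->
  let mu := @lebesgue_measure R in
  (\int[mu]_m \int[mu]_w g (reflection a k (m, w)) =
   \int[mu]_m \int[mu]_w g (m, w))%E.
Proof.
move=> mg g0 mu.
(* [h] is [g] read in the coordinates (m, y); [h'] below is [h] after the flip of m. *)
pose h (z : R * R) := g (z.1, z.2 - a * z.1).
have msh : measurable_fun setT (fun z : R * R => (z.1, z.2 - a * z.1)).
  apply: measurable_fun_pair => //=.
  by apply: measurable_funB => //; apply: measurable_funM.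
have mh : measurable_fun setT h by exact: measurableT_comp mg msh.
have h0 z : (0 <= h z)%E by exact: g0.
pose h' (z : R * R) := h (2 * k * z.2 - z.1, z.2).
have mh' : measurable_fun setT h'.
  apply: measurableT_comp mh _ => /=; apply: measurable_fun_pair => //=.
  by apply: measurable_funB => //; apply: measurable_funM.
have h'0 z : (0 <= h' z)%E by exact: h0.
have sec1 (f : R * R -> \bar R) x : measurable_fun setT f ->
    measurable_fun setT (fun y => f (x, y)).
  by move=> mf; apply: measurableT_comp mf _; exact: measurable_pair1.
have sec2 (f : R * R -> \bar R) y : measurable_fun setT f ->
    measurable_fun setT (fun x => f (x, y)).
  by move=> mf; apply: measurableT_comp mf _; exact: measurable_pair2.
have tonelli (f : R * R -> \bar R) : measurable_fun setT f ->
    (forall z, (0 <= f z)%E) ->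
    (\int[mu]_x \int[mu]_y f (x, y) = \int[mu]_y \int[mu]_x f (x, y))%E.
  by move=> mf f0; exact: (@fubini_tonelli _ _ _ _ R mu mu f mf f0).
transitivity (\int[mu]_m \int[mu]_y h' (m, y))%E.
  apply: eq_integral => m _.
  rewrite -(@ge0_integral_shift R (a * m) (fun y => h' (m, y))) //; exact: sec1.
rewrite (tonelli _ mh' h'0).
transitivity (\int[mu]_y \int[mu]_m h (m, y))%E.
  apply: eq_integral => y _.
  rewrite -(@ge0_integral_shift R (2 * k * y) (fun m => h (m, y))) //; last exact: sec2.
  rewrite -[RHS](@ge0_integral_opp R (fun x => h (2 * k * y + x, y))) //.
  apply: measurableT_comp mh _; apply: measurable_fun_pair => //.
  exact: measurable_funD.
rewrite -(tonelli _ mh h0).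
apply: eq_integral => m _.
rewrite -(@ge0_integral_shift R (- (a * m)) (fun w => g (m, w))) //; last exact: sec1.
by apply: eq_integral => w _; rewrite /h /= addrC.
Qed.

End measure_preserving_reflection.

(** * Measures given by a density *)

Section density.
Local Open Scope ereal_scope.
Context {d} {T : measurableType d} {R : realType}.
Variables (mu : {measure set T -> \bar R}) (f : T -> \bar R).
Hypothesis mf : measurable_fun setT f.
Hypothesis f0 : forall x, 0 <= f x.

(** Made into a measure so that uniqueness of the product measure can be applied to it. *)
Definition density (A : set T) := \int[mu]_(x in A) f x.

Let density0 : density set0 = 0.
Proof. exact: integral_set0. Qed.

Let density_ge0 A : 0 <= density A.
Proof. by apply: integral_ge0 => x _; exact: f0. Qed.

Let density_sigma_additive : semi_sigma_additive density.
Proof.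
move=> /= A mA tA mUA; rewrite /density ge0_integral_bigcup//; last exact: measurable_funTS.
by apply: is_cvg_ereal_nneg_natsum_cond => n _ _; exact: density_ge0.
Qed.

HB.instance Definition _ := isMeasure.Build _ _ _
  density density0 density_ge0 density_sigma_additive.

End density.

(** * Symmetries of the product of two centred normal laws *)

Section normal_product.
Context {R : realType}.
Local Notation mu := (@lebesgue_measure R).
Implicit Types s t : R.

(** A product measure is determined by its values on rectangles, and there Tonelli splits the
    integral of the product density. *)
Lemma normal_productE s t (D : set (R * R)) : measurable D ->
  ((normal_prob 0 s \x normal_prob 0 t) D =
   \int[mu \x mu]_(z in D) (normal_pdf 0 s z.1 * normal_pdf 0 t z.2)%:E)%E.
Proof.
set f : R * R -> \bar R :=
  fun z => (normal_pdf 0 s z.1 * normal_pdf 0 t z.2)%:E.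
have mf : measurable_fun setT f.
  apply/measurable_EFinP; apply: measurable_funM => /=.
    by apply: measurableT_comp => //; exact: measurable_normal_pdf.
  by apply: measurableT_comp => //; exact: measurable_normal_pdf.
have f0 z : (0 <= f z)%E by rewrite lee_fin mulr_ge0// normal_pdf_ge0.
apply: (@product_measure_unique _ _ _ _ _ (normal_prob 0 s) (normal_prob 0 t)
  (density (mu \x mu)%E f)) => A B mA mB.
rewrite /= /density integral_mkcond fubini_tonelli1//=; last 2 first.
  apply/(measurable_restrictT _ _).1 => //; first exact: measurableX.
  exact: measurable_funTS.
  by apply: erestrict_ge0.
rewrite /normal_prob [in RHS]integral_mkcond [X in (_ * X)%E]integral_mkcond.
have mr u (C : set R) : measurable C ->
    measurable_fun setT (((fun x => (normal_pdf 0 u x)%:E) : R -> \bar R) \_ C).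
  move=> mC; apply/(measurable_restrictT _ _).1 => //.
  by apply/measurable_funTS/measurable_EFinP; exact: measurable_normal_pdf.
have r0 u (C : set R) x :
    (0 <= (((fun x => (normal_pdf 0 u x)%:E) : R -> \bar R) \_ C) x)%E.
  by apply: erestrict_ge0 => y _; rewrite lee_fin normal_pdf_ge0.
rewrite -ge0_integralZr//; last 2 first.
  exact: mr.
  by apply: integral_ge0.
apply: eq_integral => x _; rewrite /fubini_F -ge0_integralZl//; last first.
  exact: mr.
apply: eq_integral => y _; rewrite !patchE in_setX.
case: (x \in A); last by rewrite mul0e.
by case: (y \in B); rewrite /= ?mule0.
Qed.

(** Here [k] is the regression coefficient of m on y = a m + w. Hence the quadratic form in the
    exponent has no cross term between y and m - k y, and flipping the sign of the latter does not
    change it. *)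
Lemma normal_pdf_reflect s t a (z : R * R) : s != 0 -> t != 0 ->
  let k := a * s ^+ 2 / (a ^+ 2 * s ^+ 2 + t ^+ 2) in
  normal_pdf 0 s (reflection a k z).1 * normal_pdf 0 t (reflection a k z).2 =
  normal_pdf 0 s z.1 * normal_pdf 0 t z.2.
Proof.
move=> s0 t0 k; rewrite /normal_pdf (negbTE s0) (negbTE t0) [LHS]mulrACA [RHS]mulrACA; congr (_ * _).
rewrite /normal_fun -!expRD; congr expR.
have : a ^+ 2 * s ^+ 2 + t ^+ 2 != 0.
  by rewrite gt_eqF// ltr_wpDl// ?exprn_even_gt0// mulr_ge0// sqr_ge0.
rewrite -/k => D0; have kD : k * (a ^+ 2 * s ^+ 2 + t ^+ 2) = a * s ^+ 2.
  by rewrite /k divfK.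
clearbody k; rewrite /reflection /=.
case: z => m w /=; set y := a * m + w; set m' := 2 * k * y - m.
have expE p q : - (p - 0) ^+ 2 / (s ^+ 2 *+ 2) + - (q - 0) ^+ 2 / (t ^+ 2 *+ 2)
    = - (p ^+ 2 * t ^+ 2 + q ^+ 2 * s ^+ 2) / (2 * s ^+ 2 * t ^+ 2).
  by rewrite -(mulr_natr (s ^+ 2)) -(mulr_natr (t ^+ 2)); field; rewrite s0 t0.
rewrite !expE; congr (- _ / _); apply/eqP; rewrite -subr_eq0; apply/eqP.
(* The difference of the two forms is a multiple of the normal equation [kD] that defines [k]. *)
transitivity (4 * (k * y - m) * y * (k * (a ^+ 2 * s ^+ 2 + t ^+ 2) - a * s ^+ 2)).
  by rewrite /m' /y; ring.
by rewrite kD subrr mulr0.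
Qed.

(** Both the density and Lebesgue measure are invariant under the reflection. *)
Lemma normal_product_reflect s t a (D : set (R * R)) :
  s != 0 -> t != 0 -> measurable D ->
  let k := a * s ^+ 2 / (a ^+ 2 * s ^+ 2 + t ^+ 2) in
  ((normal_prob 0 s \x normal_prob 0 t) (reflection a k @^-1` D) =
   (normal_prob 0 s \x normal_prob 0 t) D)%E.
Proof.
move=> s0 t0 mD k.
have mS : measurable (reflection a k @^-1` D).
  by rewrite -[X in measurable X]setTI; exact: measurable_reflection.
rewrite !normal_productE// integral_mkcond [RHS]integral_mkcond.
set f : R * R -> \bar R :=
  fun z => (normal_pdf 0 s z.1 * normal_pdf 0 t z.2)%:E.
have mf : measurable_fun setT f.
  apply/measurable_EFinP; apply: measurable_funM => /=.
    by apply: measurableT_comp => //; exact: measurable_normal_pdf.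
  by apply: measurableT_comp => //; exact: measurable_normal_pdf.
have f0 z : (0 <= f z)%E by rewrite lee_fin mulr_ge0// normal_pdf_ge0.
have mfD (E : set (R * R)) : measurable E -> measurable_fun setT (f \_ E).
  by move=> mE; apply/(measurable_restrictT _ _).1 => //; exact: measurable_funTS.
have fD0 (E : set (R * R)) z : (0 <= (f \_ E) z)%E.
  by apply: erestrict_ge0.
have tonelli (E : set (R * R)) : measurable E ->
    (\int[mu \x mu]_z (f \_ E) z = \int[mu]_x \int[mu]_y (f \_ E) (x, y))%E.
  by move=> mE; exact: (@fubini_tonelli1 _ _ _ _ R mu mu (f \_ E) (mfD _ mE) (fD0 _)).
rewrite (tonelli _ mS) (tonelli _ mD).
rewrite -[RHS](@ge0_integral_reflection R a k); last 2 first.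
- exact: mfD.
- exact: fD0.
apply: eq_integral => x _; apply: eq_integral => y _.
have memE : ((x, y) \in reflection a k @^-1` D) = (reflection a k (x, y) \in D).
  by apply/idP/idP; rewrite !inE.
rewrite !patchE memE; case: ifP => // _; apply: (congr1 EFin).
exact: esym (normal_pdf_reflect _ _ a (x, y) s0 t0).
Qed.

Lemma normal_probN s (D : set R) : s != 0 -> measurable D ->
  normal_prob 0 s (-%R @^-1` D) = normal_prob 0 s D.
Proof.
move=> s0 mD; rewrite /normal_prob integral_mkcond [RHS]integral_mkcond.
rewrite -[RHS](@ge0_integral_opp R); last 2 first.
- apply/(measurable_restrictT _ _).1 => //.
  by apply/measurable_funTS/measurable_EFinP; exact: measurable_normal_pdf.
- by apply: erestrict_ge0 => y _; rewrite lee_fin normal_pdf_ge0.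
apply: eq_integral => x _; have memE : (x \in (-%R : R -> R) @^-1` D) = (- x \in D).
  by apply/idP/idP; rewrite !inE.
by rewrite !patchE memE /normal_pdf (negbTE s0) /normal_fun !subr0 sqrrN.
Qed.

End normal_product.

(** * Coordinatewise measurability of vectors, and boxes *)

Section measurable_cV.
Context {d} {T : measurableType d}.

Lemma measurable_coord n (i : 'I_n) :
  measurable_fun setT (fun v : 'cV[T]_n => v i ord0).
Proof.
move=> _ Y mY; rewrite setTI; apply: sub_sigma_algebra => /=.
rewrite -bigcup_seq/=; exists i => /=; first by rewrite mem_index_enum.
by exists Y => //; rewrite setTI.
Qed.

Lemma measurable_fun_cV d' (U : measurableType d') n (f : U -> 'cV[T]_n) :
  (forall i, measurable_fun setT (fun x => f x i ord0)) ->
  measurable_fun setT f.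
Proof.
move=> mf; apply: (@measurability _ _ _ _ _ _
  (\big[setU/set0]_(i < n) preimage_set_system setT
     (fun v : 'cV[T]_n => v i ord0) measurable)) => //.
move=> _ [A + <-]; rewrite -bigcup_seq => -[i _ [B mB <-]].
by rewrite !setTI; rewrite -[X in measurable X]setTI; exact: mf.
Qed.

Lemma measurable_fun_coord d' (U : measurableType d') n (f : U -> 'cV[T]_n) i :
  measurable_fun setT f -> measurable_fun setT (fun x => f x i ord0).
Proof. move=> mf; exact: (measurableT_comp (measurable_coord n i) mf). Qed.

Definition box {n} (A : 'I_n -> set T) : set 'cV[T]_n :=
  [set v | forall i, A i (v i ord0)].

Lemma measurable_box n (A : 'I_n -> set T) :
  (forall i, measurable (A i)) -> measurable (box A).
Proof.
move=> mA.
have -> : box A = \bigcap_(i in setT) ((fun v : 'cV[T]_n => v i ord0) @^-1` A i).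
  by apply/seteqP; split => [v Av i _|v Av i]; exact: Av.
apply: fin_bigcap_measurable => // i _.
by rewrite -[X in measurable X]setTI; exact: measurable_coord.
Qed.

End measurable_cV.

(** * Gaussian vectors with diagonal covariance on boxes *)

Section gaussian_box.
Context {R : realType}.
Local Notation mu := (@lebesgue_measure R).

(** The free constant [c] carries the induction: for each value x of the outer variable, the factor
    [f ord0 x] is absorbed into it. *)
Lemma integral_cV_prod n (f : 'I_n -> R -> R) (c : R) :
  (forall i, measurable_fun setT (f i)) -> (forall i x, 0 <= f i x) -> 0 <= c ->
  integral_cV (fun v : 'cV[R]_n => (c * \prod_i f i (v i ord0))%:E) =
  (c%:E * \prod_(i < n) \int[mu]_x (f i x)%:E)%E.
Proof.
elim: n f c => [|n IH] f c mf f0 c0 /=; first by rewrite !big_ord0 mule1 mulr1.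
transitivity (\int[mu]_x ((c * f ord0 x)%:E *
    \prod_(i < n) \int[mu]_x (f (lift ord0 i) x)%:E)%E)%E.
  apply: eq_integral => x _.
  rewrite -IH//; last by rewrite mulr_ge0.
  congr integral_cV; apply/funext => v.
  rewrite big_ord_recl mulrA; congr (_ * _ * _)%:E.
    congr (f _ _).
    have -> : (ord0 : 'I_n.+1) = lshift n (ord0 : 'I_1) by exact/val_inj.
    by apply: etrans (col_mxEu _ _ ord0 ord0) _; rewrite mxE.
  apply: eq_bigr => i _; congr (f _ _).
  have -> : lift ord0 i = rshift 1 i by exact/val_inj.
  exact: col_mxEd.
rewrite ge0_integralZr//; last 3 first.
- by apply/measurable_EFinP; apply: measurable_funM => //; exact: mf.
- by move=> x _; rewrite lee_fin mulr_ge0.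
- by apply: prode_ge0 => i _; apply: integral_ge0 => x _; rewrite lee_fin.
under eq_integral do rewrite EFinM.
rewrite ge0_integralZl//; first by rewrite big_ord_recl muleA.
- by apply/measurable_EFinP; exact: mf.
- by move=> x _; rewrite lee_fin.
Qed.

(** A diagonal covariance has an explicit determinant and inverse, so the normalizing constant is a
    product and the exponent a sum over coordinates. *)
Lemma gaussian_pdf_diag n (s : 'I_n -> R) (x : 'cV[R]_n) :
  (forall i, 0 < s i) ->
  gaussian_pdf 0 (diag_mx (\row_i s i ^+ 2)) x =
  \prod_i normal_pdf 0 (s i) (x i ord0).
Proof.
move=> s0.
have inv : invmx (diag_mx (\row_i s i ^+ 2)) = diag_mx (\row_i (s i ^+ 2)^-1).
  have D1 : diag_mx (\row_i s i ^+ 2) *m diag_mx (\row_i (s i ^+ 2)^-1) = 1%:M.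
    rewrite mulmx_diag -diag_const_mx; congr diag_mx; apply/rowP => i.
    by rewrite !mxE divff// expf_neq0// gt_eqF.
  have [U _] := mulmx1_unit D1.
  by rewrite -[RHS]mul1mx -(mulVmx U) -mulmxA D1 mulmx1.
have sq (r : seq 'I_n) : \prod_(i <- r) normal_peak (s i) =
    (Num.sqrt (\prod_(i <- r) (s i ^+ 2 * pi *+ 2)))^-1.
  elim: r => [|i r IH]; first by rewrite !big_nil sqrtr1 invr1.
  rewrite !big_cons sqrtrM ?invfM ?IH//.
  by rewrite mulrn_wge0// mulr_ge0 ?sqr_ge0// pi_ge0.
transitivity (\prod_i (normal_peak (s i) * normal_fun 0 (s i) (x i ord0))).
  rewrite big_split /= sq /gaussian_pdf; congr (_^-1 * _).
    rewrite det_diag; congr Num.sqrt.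
    have -> : (2 * pi) ^+ n = \prod_(i < n) (2 * pi) :> R.
      by rewrite prodr_const card_ord.
    rewrite -big_split; apply: eq_bigr => i _ /=.
    by rewrite mxE; ring.
  rewrite inv /normal_fun -expR_sum; congr expR.
  rewrite subr0 mul_mx_diag mxE.
  rewrite -sumrN mulr_suml.
  apply: eq_bigr => i _; rewrite !mxE subr0.
  by field; rewrite gt_eqF.
by apply: eq_bigr => i _; rewrite /normal_pdf gt_eqF.
Qed.

(** The density and the indicator of a box both factor over the coordinates, so the iterated
    integral does too. *)
Lemma gaussian_vector_box d (T : measurableType d) (P : probability T R)
    n (X : {RV P >-> 'cV[R]_n}) (s : 'I_n -> R) (A : 'I_n -> set R) :
  (forall i, 0 < s i) ->
  gaussian_vector X 0 (diag_mx (\row_i s i ^+ 2)) ->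
  (forall i, measurable (A i)) ->
  P (X @^-1` box A) = (\prod_(i < n) normal_prob 0 (s i) (A i))%E.
Proof.
move=> s0 [_ _ PX] mA; rewrite PX; last exact: measurable_box.
transitivity (integral_cV (fun v : 'cV[R]_n =>
    (1 * \prod_i (normal_pdf 0 (s i) (v i ord0) * \1_(A i) (v i ord0)))%:E)).
  congr integral_cV; apply/funext => v; rewrite mul1r gaussian_pdf_diag//.
  rewrite big_split/=; congr (_ * _)%:E; rewrite indicE.
  have [/forallP Av|] := boolP [forall i, v i ord0 \in A i].
    rewrite mem_set; last by move=> i; have := Av i; rewrite inE.
    by rewrite big1// => i _; rewrite indicE Av.
  rewrite negb_forall => /existsP[i nAi].
  rewrite memNset; last by move=> /(_ i) Ai; rewrite mem_set in nAi.
  by rewrite (bigD1 i)//= indicE (negbTE nAi) mul0r.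
rewrite (@integral_cV_prod n (fun i x => normal_pdf 0 (s i) x * \1_(A i) x))//; last 2 first.
- move=> i; apply: measurable_funM => //; exact: measurable_normal_pdf.
- by move=> i x; rewrite mulr_ge0 ?normal_pdf_ge0.
rewrite mul1e; apply: eq_bigr => i _.
rewrite /normal_prob [RHS]integral_mkcond; apply: eq_integral => x _.
rewrite patchE indicE; case: (x \in A i); by rewrite ?mulr1 ?mulr0.
Qed.

End gaussian_box.

(** * A generating pi-system for pairs of vectors *)

Section box_pairs.
Context {d} {T : measurableType d} {n : nat}.
Local Notation V := 'cV[T]_n.

(** The pi-system on which two laws of a pair of vectors are compared. *)
Definition box_pairs : set (set (V * V)) :=
  [set D | exists A B : 'I_n -> set T,
    [/\ forall i, measurable (A i), forall i, measurable (B i)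
      & D = box A `*` box B]].

Lemma boxT : box (fun=> setT) = setT :> set V.
Proof. exact/seteqP. Qed.

Lemma boxI (A B : 'I_n -> set T) :
  box A `&` box B = box (fun i => A i `&` B i) :> set V.
Proof.
apply/seteqP; split => [v [Av Bv] i|v ABv]; first by split; [exact: Av|exact: Bv].
by split => i; have [] := ABv i.
Qed.

Lemma box_pairs_setI : setI_closed box_pairs.
Proof.
move=> _ _ [A [B [mA mB ->]]] [A' [B' [mA' mB' ->]]].
exists (fun i => A i `&` A' i), (fun i => B i `&` B' i); split.
- by move=> i; exact: measurableI.
- by move=> i; exact: measurableI.
- by rewrite -setXI !boxI.
Qed.

Lemma measurable_box_pairs : measurable = <<s box_pairs >>.
Proof.
apply/seteqP; split; last first.
  apply: smallest_sub; first exact: sigma_algebra_measurable.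
  move=> _ [A [B [mA mB ->]]]; apply: measurableX; exact: measurable_box.
(* For the harder inclusion, the identity from pairs with the generated sigma-algebra is shown
   measurable through its two projections. *)
pose GT := g_sigma_algebraType box_pairs.
have box1 i (C : set T) : [set v : V | C (v i ord0)] =
    box (fun j => if j == i then C else setT).
  apply/seteqP; split => [v Cv j|v /(_ i)]; first by case: eqP => // ->.
  by rewrite eqxx.
have m1 : measurable_fun [set: GT] (fst : GT -> V).
  apply: measurable_fun_cV => i _ C mC; rewrite setTI; apply: sub_sigma_algebra.
  exists (fun j => if j == i then C else setT), (fun=> setT); split => //.
    by move=> j; case: ifP.
  rewrite -box1 boxT; apply/seteqP; split => [[v w]|[v w] []] //=.
have m2 : measurable_fun [set: GT] (snd : GT -> V).
  apply: measurable_fun_cV => i _ C mC; rewrite setTI; apply: sub_sigma_algebra.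
  exists (fun=> setT), (fun j => if j == i then C else setT); split => //.
    by move=> j; case: ifP.
  rewrite -box1 boxT; apply/seteqP; split => [[v w]|[v w] []] //=.
move=> D mD.
have mid : measurable_fun [set: GT] (fun z : GT => (fst z, snd z) : V * V).
  exact: measurable_fun_pair.
have := mid measurableT _ mD; rewrite setTI.
have -> // : (fun z : GT => (fst z, snd z) : V * V) @^-1` D = D.
by apply/seteqP; split => -[].
Qed.

Definition set_coord (k : 'I_n) (f : T * T -> T * T) (z : V * V) : V * V :=
  let p := f (z.1 k ord0, z.2 k ord0) in
  (\col_i (if i == k then p.1 else z.1 i ord0),
   \col_i (if i == k then p.2 else z.2 i ord0)).

Lemma measurable_set_coord k f :
  measurable_fun setT f -> measurable_fun setT (set_coord k f).
Proof.
move=> mf.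
have m1 i : measurable_fun setT (fun z : V * V => z.1 i ord0).
  exact: measurable_fun_coord.
have m2 i : measurable_fun setT (fun z : V * V => z.2 i ord0).
  exact: measurable_fun_coord.
have mfk : measurable_fun setT (fun z : V * V => f (z.1 k ord0, z.2 k ord0)).
  by apply: measurableT_comp mf _; exact: measurable_fun_pair.
apply: measurable_fun_pair; apply: measurable_fun_cV => i.
  under eq_fun do rewrite mxE.
  case: eqP => _; [exact: (measurableT_comp measurable_fst mfk)|exact: m1].
under eq_fun do rewrite mxE.
by case: eqP => _; [exact: (measurableT_comp measurable_snd mfk)|exact: m2].
Qed.

End box_pairs.

(** * Invariance of the joint law under a change of one coordinate pair *)

Section joint_law.
Context {R : realType} {d} {T : measurableType d} {P : probability T R} {n : nat}.
Variables (M W : {RV P >-> 'cV[R]_n}) (s t : 'I_n -> R).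
Hypothesis s_gt0 : forall i, 0 < s i.
Hypothesis t_gt0 : forall i, 0 < t i.
Hypothesis gaussM : gaussian_vector M 0 (diag_mx (\row_i s i ^+ 2)).
Hypothesis gaussW : gaussian_vector W 0 (diag_mx (\row_i t i ^+ 2)).
Hypothesis indep : independent_RV M W.
Variables (k : 'I_n) (f : R * R -> R * R).
Hypothesis mf : measurable_fun setT f.
Hypothesis f_law : forall D, measurable D ->
  ((normal_prob 0 (s k) \x normal_prob 0 (t k)) (f @^-1` D) =
   (normal_prob 0 (s k) \x normal_prob 0 (t k)) D)%E.

Let joint (omega : T) := (M omega, W omega).

Let mjoint : measurable_fun setT joint.
Proof. exact: measurable_fun_pair. Qed.

Let joint_k (omega : T) := (M omega k ord0, W omega k ord0).

Let mjoint_k : measurable_fun setT joint_k.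
Proof.
by apply: measurable_fun_pair; exact: measurable_fun_coord.
Qed.

Let repl (A : 'I_n -> set R) (E : set R) i := if i == k then E else A i.

Let mrepl A E : (forall i, measurable (A i)) -> measurable E ->
  forall i, measurable (repl A E i).
Proof. by move=> mA mE i; rewrite /repl; case: ifP. Qed.

Section fixed_box.
Variables A B : 'I_n -> set R.
Hypothesis mA : forall i, measurable (A i).
Hypothesis mB : forall i, measurable (B i).

(** The event that all coordinates other than [k] lie in their sides of the boxes; coordinate [k] is
    left free. *)
Let N := (M @^-1` box (repl A setT)) `&` (W @^-1` box (repl B setT)).

Let mN : measurable N.
Proof.
by apply: measurableI; rewrite -[X in measurable X]setTI;
  apply: measurable_funP => //; apply: measurable_box; exact: mrepl.
Qed.

Let joint_k_box E F :
  joint_k @^-1` (E `*` F) `&` N =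
  (M @^-1` box (repl A E)) `&` (W @^-1` box (repl B F)).
Proof.
apply/seteqP; split => omega /=.
  move=> [[/= Ek Fk] [Mb Wb]]; split => i; rewrite /repl.
    by case: eqP => [->//|/eqP ik]; have := Mb i; rewrite /repl (negbTE ik).
  by case: eqP => [->//|/eqP ik]; have := Wb i; rewrite /repl (negbTE ik).
move=> [Mb Wb]; split; [split|split] => /=.
- by have := Mb k; rewrite /repl eqxx.
- by have := Wb k; rewrite /repl eqxx.
- by move=> i; have := Mb i; rewrite /repl; case: ifP.
- by move=> i; have := Wb i; rewrite /repl; case: ifP.
Qed.

(** The unnormalized law of the k-th coordinate pair on the event [N]. *)
Let nu := pushforward (mrestr P mN) joint_k.

(** By independence [nu] is a constant multiple of the product of the two normal laws at [k], so it
    inherits their invariance under [f]. *)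
Let nu_invariant D : measurable D -> nu (f @^-1` D) = nu D.
Proof.
(* [c] is the probability of [N]. It is first put into the left factor, since uniqueness concerns
   product measures, and then pulled out by [scaleE]. *)
pose c : R := \prod_(i < n | i != k) fine (normal_prob 0 (s i) (A i)) *
              \prod_(i < n | i != k) fine (normal_prob 0 (t i) (B i)).
have c0 : 0 <= c.
  by rewrite mulr_ge0// prodr_ge0// => i _; exact: fine_ge0.
pose m1 := mscale (NngNum c0) (normal_prob 0 (s k)).
have nuE E : measurable E -> (m1 \x normal_prob 0 (t k))%E E = nu E.
  pose J : T -> measurableTypeR R * measurableTypeR R := joint_k.
  have mJ : measurable_fun setT J by exact: mjoint_k.
  pose nu1 : {measure set (measurableTypeR R * measurableTypeR R) -> \bar R} :=
    pushforward (mrestr P mN) J.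
  apply: (@product_measure_unique _ _ _ _ R m1 (normal_prob 0 (t k)) (nu1 mJ)).
  move=> E1 E2 mE1 mE2.
  rewrite /nu1 /= /pushforward /mrestr joint_k_box indep; last 2 first.
  - by apply: measurable_box; exact: mrepl.
  - by apply: measurable_box; exact: mrepl.
  rewrite (@gaussian_vector_box R _ T P n M s _ s_gt0 gaussM); last exact: mrepl.
  rewrite (@gaussian_vector_box R _ T P n W t _ t_gt0 gaussW); last exact: mrepl.
  rewrite (bigD1 k)//= [X in (_ * X)%E](bigD1 k)//= /repl eqxx.
  rewrite /m1 /mscale /= /c EFinM -!prodEFin.
  have prodE (u : 'I_n -> R) (C : 'I_n -> set R) E0 :
      (forall i, measurable (C i)) ->
      (\prod_(i < n | i != k) normal_prob 0 (u i) (if i == k then E0 else C i) =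
       \prod_(i < n | i != k) (fine (normal_prob 0 (u i) (C i)))%:E)%E.
    move=> mC; apply: eq_bigr => i /negbTE ->.
    by rewrite fineK//; apply: fin_num_measure; exact: mC.
  by rewrite (prodE _ _ _ mA) (prodE _ _ _ mB) muleACA muleC muleA.
have scaleE E : measurable E ->
    (m1 \x normal_prob 0 (t k))%E E =
    (c%:E * (normal_prob 0 (s k) \x normal_prob 0 (t k)) E)%E.
  move=> mE; rewrite /product_measure1 /m1 ge0_integral_mscale//.
  exact: measurable_fun_xsection.
move=> mD.
have mfD : measurable (f @^-1` D) by rewrite -[X in measurable X]setTI; exact: mf.
apply: etrans (esym (nuE _ mfD)) _; apply: etrans (scaleE _ mfD) _.
apply: etrans _ (nuE _ mD); apply: etrans _ (esym (scaleE _ mD)).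
by rewrite (f_law _ mD).
Qed.

(** Since [set_coord] leaves the event [N] alone, both sides are values of [nu]: at the k-th
    rectangle and at its preimage under [f]. *)
Lemma joint_box_invariant :
  P (joint @^-1` (box A `*` box B)) =
  P ((set_coord k f \o joint) @^-1` (box A `*` box B)).
Proof.
have reE (C : 'I_n -> set R) i : repl C (C k) i = C i.
  by rewrite /repl; case: eqP => // ->.
have mAB : measurable (A k `*` B k) by exact: measurableX.
transitivity (nu (A k `*` B k)).
  rewrite /nu /pushforward /mrestr joint_k_box; congr (P _).
  have -> : repl A (A k) = A by apply/funext.
  by have -> : repl B (B k) = B by apply/funext.
rewrite -nu_invariant// /nu /pushforward /mrestr; congr (P _).
apply/seteqP; split => omega /=.
  move=> [[/= Ek Fk] [Mb Wb]]; split => i; rewrite mxE.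
    by case: eqP => [->//|/eqP ik]; have := Mb i; rewrite /repl (negbTE ik).
  by case: eqP => [->//|/eqP ik]; have := Wb i; rewrite /repl (negbTE ik).
move=> [Mb Wb]; split; [split|split] => /=.
- by have := Mb k; rewrite mxE eqxx.
- by have := Wb k; rewrite mxE eqxx.
- by move=> i; have := Mb i; rewrite mxE /repl; case: ifP.
- by move=> i; have := Wb i; rewrite mxE /repl; case: ifP.
Qed.

End fixed_box.

(** The two pushforward laws agree on the pi-system [box_pairs], hence everywhere. *)
Lemma ge0_integral_set_coord (g : 'cV[R]_n * 'cV[R]_n -> \bar R) :
  measurable_fun setT g -> (forall z, (0 <= g z)%E) ->
  (\int[P]_w g (M w, W w) = \int[P]_w g (set_coord k f (M w, W w)))%E.
Proof.
move=> mg g0.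
have mS : measurable_fun setT (set_coord k f \o joint).
  by apply: measurableT_comp => //; exact: measurable_set_coord.
transitivity (\int[pushforward P joint]_z g z)%E.
  by rewrite ge0_integral_pushforward.
transitivity (\int[pushforward P (set_coord k f \o joint)]_z g z)%E; last first.
  by rewrite ge0_integral_pushforward.
apply: eq_measure_integral => D mD _.
apply: (measure_unique box_pairs (fun=> setT)) => //.
- exact: measurable_box_pairs.
- exact: box_pairs_setI.
- by move=> _; exists (fun=> setT), (fun=> setT); split => //; rewrite boxT setXTT.
- by rewrite bigcup_const.
- by move=> _ [A [B [mA mB ->]]]; exact: joint_box_invariant.
- by move=> _; rewrite /= /pushforward preimage_setT probability_setT ltry.
Qed.

End joint_law.

(** For each fixed first coordinate, the section is handled by the evenness of the normal law. *)
Lemma normal_product_oppr {R : realType} (s t : R) (D : set (R * R)) :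
  t != 0 -> measurable D ->
  ((normal_prob 0 s \x normal_prob 0 t)
     ((fun z : R * R => (z.1, - z.2)%R) @^-1` D) =
   (normal_prob 0 s \x normal_prob 0 t) D)%E.
Proof.
move=> t0 mD; rewrite /product_measure1; apply: eq_integral => x _ /=.
by rewrite -[RHS]normal_probN//; exact: measurable_xsection.
Qed.

Lemma lee_double {R : realType} (x y : \bar R) :
  (0 <= x -> 0 <= y -> x + x <= y + y -> x <= y)%E.
Proof.
case: x => [x| |]; case: y => [y| |] //=; rewrite ?leey ?lee_fin//.
by move=> _ _; rewrite -!mulr2n ler_pMn2r.
Qed.

(** * Measurable vector operations and affine policies *)

Section measurable_cV_ops.
Context {R : realType} {d} {U : measurableType d} {n : nat}.
Implicit Types f g : U -> 'cV[R]_n.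

Lemma measurable_cVD f g : measurable_fun setT f -> measurable_fun setT g ->
  measurable_fun setT (fun x => f x + g x).
Proof.
move=> mf mg; apply: measurable_fun_cV => i.
under eq_fun do rewrite mxE.
by apply: measurable_funD; exact: measurable_fun_coord.
Qed.

Lemma measurable_cVB f g : measurable_fun setT f -> measurable_fun setT g ->
  measurable_fun setT (fun x => f x - g x).
Proof.
move=> mf mg; apply: measurable_fun_cV => i.
under eq_fun do rewrite !mxE.
by apply: measurable_funB; exact: measurable_fun_coord.
Qed.

Lemma measurable_affine m (A : 'M[R]_(m, n)) (C : 'cV[R]_m) :
  measurable_fun setT (fun v : 'cV[R]_n => A *m v + C).
Proof.
apply: measurable_fun_cV => i; under eq_fun do rewrite !mxE.
apply: measurable_funD => //; apply: measurable_sum => j.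
by apply: measurable_funM => //; exact: measurable_coord.
Qed.

End measurable_cV_ops.

(** Named so that affine policies can carry the structure of measurable functions. *)
Definition affine_map {R : realType} {n} (A : 'M[R]_n) (C : 'cV[R]_n)
  (v : 'cV[R]_n) : 'cV[R]_n := A *m v + C.

HB.instance Definition _ (R : realType) n (A : 'M[R]_n) (C : 'cV[R]_n) :=
  isMeasurableFun.Build _ _ _ _ (affine_map A C) (measurable_affine n A C).

Lemma affine_map_diagE {R : realType} {n} (a : 'rV[R]_n) (C v : 'cV[R]_n) i :
  affine_map (diag_mx a) C v i ord0 = a ord0 i * v i ord0 + C i ord0.
Proof. by rewrite /affine_map mxE mul_diag_mx mxE. Qed.

(** * Best responses by symmetrization *)

Section best_response.
Context {R : realType} {d} {T : measurableType d} {P : probability T R} {n : nat}.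
Variables (M W : {RV P >-> 'cV[R]_n}) (s t : 'I_n -> R).
Hypothesis s_gt0 : forall i, 0 < s i.
Hypothesis t_gt0 : forall i, 0 < t i.
Hypothesis gaussM : gaussian_vector M 0 (diag_mx (\row_i s i ^+ 2)).
Hypothesis gaussW : gaussian_vector W 0 (diag_mx (\row_i t i ^+ 2)).
Hypothesis indep : independent_RV M W.
Local Notation V := 'cV[R]_n.

Let mMW : measurable_fun setT (fun omega => (M omega, W omega)).
Proof. exact: measurable_fun_pair. Qed.

(** Invariance turns twice the integral of [F] into that of [F] plus its transform, so the pointwise
    bound can be integrated and then halved. Nonnegativity replaces integrability, so infinite costs
    are covered. *)
Lemma ge0_le_integral_symmetrized (k : 'I_n) (f : R * R -> R * R)
    (F G : V * V -> R) :
  measurable_fun setT f ->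
  (forall D, measurable D ->
    ((normal_prob 0 (s k) \x normal_prob 0 (t k)) (f @^-1` D) =
     (normal_prob 0 (s k) \x normal_prob 0 (t k)) D)%E) ->
  measurable_fun setT F -> measurable_fun setT G ->
  (forall z, 0 <= F z) -> (forall z, 0 <= G z) ->
  (forall z, F z + F (set_coord k f z) <= G z + G (set_coord k f z)) ->
  (\int[P]_w (F (M w, W w))%:E <= \int[P]_w (G (M w, W w))%:E)%E.
Proof.
move=> mf f_law mF mG F0 G0 FG.
have intS (H : V * V -> R) : measurable_fun setT H -> (forall z, 0 <= H z) ->
    (\int[P]_w (H (M w, W w))%:E + \int[P]_w (H (M w, W w))%:E =
     \int[P]_w (H (M w, W w) + H (set_coord k f (M w, W w)))%:E)%E.
  move=> mH H0.
  rewrite [X in (_ + X)%E](@ge0_integral_set_coord R _ T P n M W s t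
    s_gt0 t_gt0 gaussM gaussW indep k f mf f_law (EFin \o H)); last 2 first.
  - exact/measurable_EFinP.
  - by move=> z; rewrite lee_fin.
  have m1 : measurable_fun setT (fun w => (H (M w, W w))%:E).
    by apply/measurable_EFinP; exact: (measurableT_comp mH mMW).
  have m2 : measurable_fun setT (fun w => (H (set_coord k f (M w, W w)))%:E).
    apply/measurable_EFinP; apply: (measurableT_comp mH).
    by apply: measurableT_comp mMW; exact: measurable_set_coord.
  by rewrite -ge0_integralD// => w _; rewrite lee_fin.
apply: lee_double.
- by apply: integral_ge0 => w _; rewrite lee_fin.
- by apply: integral_ge0 => w _; rewrite lee_fin.
have mS (H : V * V -> R) : measurable_fun setT H ->
    measurable_fun setT (fun w => (H (M w, W w) + H (set_coord k f (M w, W w)))%:E).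
  move=> mH; apply/measurable_EFinP; apply: measurable_funD.
    exact: (measurableT_comp mH mMW).
  apply: (measurableT_comp mH).
  by apply: measurableT_comp mMW; exact: measurable_set_coord.
rewrite !intS//; apply: ge0_le_integral => //.
- by move=> w _; rewrite lee_fin addr_ge0.
- exact: mS.
- exact: mS.
- by move=> w _; rewrite lee_fin.
Qed.

(** The costs are sums over coordinates, and each summand may be compared with its own symmetry. *)
Lemma ge0_le_expectation_symmetrized (f : 'I_n -> R * R -> R * R)
    (F G : 'I_n -> V * V -> R) :
  (forall k, measurable_fun setT (f k)) ->
  (forall k D, measurable D ->
    ((normal_prob 0 (s k) \x normal_prob 0 (t k)) (f k @^-1` D) =
     (normal_prob 0 (s k) \x normal_prob 0 (t k)) D)%E) ->
  (forall k, measurable_fun setT (F k)) ->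
  (forall k, measurable_fun setT (G k)) ->
  (forall k z, 0 <= F k z) -> (forall k z, 0 <= G k z) ->
  (forall k z, F k z + F k (set_coord k (f k) z) <=
               G k z + G k (set_coord k (f k) z)) ->
  ('E_P[fun w => (\sum_k F k (M w, W w))%R] <=
   'E_P[fun w => (\sum_k G k (M w, W w))%R])%E.
Proof.
move=> mf f_law mF mG F0 G0 FG; rewrite unlock.
have sumE (H : 'I_n -> V * V -> R) : (forall k, measurable_fun setT (H k)) ->
    (forall k z, 0 <= H k z) ->
    (\int[P]_w (\sum_k H k (M w, W w))%R%:E =
     \sum_(k < n) \int[P]_w (H k (M w, W w))%:E)%E.
  move=> mH H0; under eq_integral do rewrite -sumEFin.
  rewrite ge0_integral_sum// => k.
    by apply/measurable_EFinP; exact: (measurableT_comp (mH k) mMW).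
  by move=> w _; rewrite lee_fin.
rewrite !sumE//; apply: lee_sum => k _.
exact: (ge0_le_integral_symmetrized k (f k) (F k) (G k) (mf k) (f_law k)
  (mF k) (mG k) (F0 k) (G0 k) (FG k)).
Qed.

Section responses.
Variables (b : V) (lambda : R) (a kappa : 'rV[R]_n) (c l : V).

Let mcoord (g : V * V -> V) i : measurable_fun setT g ->
  measurable_fun setT (fun z => g z i ord0).
Proof. exact: measurable_fun_coord. Qed.

(* For fixed m, replacing w_i by - w_i removes the cross term between the
   noise and the rest of the error; what remains is quadratic in x_i. *)
Lemma encoder_best_response (ge' : {mfun V >-> V}) : 0 < lambda ->
  (forall i, a ord0 i = kappa ord0 i / (kappa ord0 i ^+ 2 + lambda)) ->
  (forall i, c i ord0 = - (a ord0 i * (b i ord0 + l i ord0))) ->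
  (encoder_cost M W b lambda (affine_map (diag_mx a) c)
     (affine_map (diag_mx kappa) l) <=
   encoder_cost M W b lambda ge' (affine_map (diag_mx kappa) l))%E.
Proof.
move=> lambda_gt0 aE cE; rewrite /encoder_cost.
have subB (u v w : V) k : (u - v - w) k ord0 = u k ord0 - v k ord0 - w k ord0.
  by rewrite !mxE.
(* The share of coordinate i in the cost. As the decoder is diagonal, it involves m, x and w only
   through their i-th entries. *)
pose cost (ge : V -> V) i (z : V * V) : R :=
  (z.1 - affine_map (diag_mx kappa) l (ge z.1 + z.2) - b) i ord0 ^+ 2 +
  lambda * ge z.1 i ord0 ^+ 2.
have mcost (ge : {mfun V >-> V}) i : measurable_fun setT (cost ge i).
  have mg : measurable_fun setT (fun z : V * V => ge z.1) by exact: measurableT_comp.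
  apply: measurable_funD; last first.
    by apply: measurable_funM => //; apply: measurable_funX; exact: mcoord.
  apply: measurable_funX; apply: measurable_fun_coord.
  apply: measurable_cVB => //; apply: measurable_cVB => //.
  exact: (measurableT_comp (measurable_affine _ _ _) (measurable_cVD _ _ mg _)).
have costkE ge k z : cost ge k z =
    (z.1 k ord0 - (kappa ord0 k * (ge z.1 k ord0 + z.2 k ord0) + l k ord0) -
     b k ord0) ^+ 2 + lambda * ge z.1 k ord0 ^+ 2.
  by rewrite /cost subB affine_map_diagE [in X in X ^+ 2 + _](mxE _ _ k).
have cost0 (ge : V -> V) i z : 0 <= cost ge i z.
  by rewrite addr_ge0 ?sqr_ge0// mulr_ge0 ?sqr_ge0// ltW.
have costE (ge : V -> V) (w : T) :
    sqnorm (M w - affine_map (diag_mx kappa) l (ge (M w) + W w) - b) +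
    lambda * sqnorm (ge (M w)) = \sum_i cost ge i (M w, W w).
  by rewrite /sqnorm mulr_sumr -big_split.
under [X in ('E__[X] <= _)%E]eq_fun do rewrite costE.
under [X in (_ <= 'E__[X])%E]eq_fun do rewrite costE.
apply: (ge0_le_expectation_symmetrized (fun _ z => (z.1, - z.2))
  (cost (affine_map (diag_mx a) c)) (cost ge') _ _ (mcost _) (mcost _)
  (cost0 _) (cost0 _)).
- by move=> _; apply: measurable_fun_pair => //; exact: measurableT_comp.
- by move=> k D mD; apply: normal_product_oppr => //; rewrite gt_eqF.
move=> k z; rewrite !costkE /=.
(* The sign change fixes m, so each encoder sends the same signal at both points. *)
have -> : \col_i (if i == k then z.1 k ord0 else z.1 i ord0) = z.1.
  by apply/colP => i; rewrite mxE; case: eqP => // ->.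
rewrite affine_map_diagE mxE eqxx aE cE aE.
move: (z.1 k ord0) (z.2 k ord0) (ge' z.1 k ord0) (kappa ord0 k) (l k ord0)
  (b k ord0) => m w x' r e f.
set D := r ^+ 2 + lambda.
have D_gt0 : 0 < D by rewrite ltr_wpDl// sqr_ge0.
set x := r / D * m + _.
(* The first-order condition for the cost averaged over the sign of w; it cancels the linear term
   once the square is completed around [x]. *)
have xE : D * x = r * (m - e - f) by rewrite /x; field; rewrite gt_eqF.
rewrite -subr_ge0.
rewrite [leRHS](_ : _ = 2 * D * (x' - x) ^+ 2
    + 4 * (x' - x) * (D * x - r * (m - e - f))); last by rewrite /D; ring.
by rewrite xE subrr mulr0 addr0 mulr_ge0 ?sqr_ge0// mulr_ge0// ltW.
Qed.

(* The reflection of (m_i, w_i) fixes y_i = a m_i + c + w_i and moves m_i to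
   2 u_i - m_i, where u_i is the decoder's estimate. *)
Lemma decoder_best_response (gd' : {mfun V >-> V}) :
  (forall i, kappa ord0 i =
     a ord0 i * s i ^+ 2 / (a ord0 i ^+ 2 * s i ^+ 2 + t i ^+ 2)) ->
  (forall i, l i ord0 = - (kappa ord0 i * c i ord0)) ->
  (decoder_cost M W (affine_map (diag_mx a) c) (affine_map (diag_mx kappa) l) <=
   decoder_cost M W (affine_map (diag_mx a) c) gd')%E.
Proof.
move=> kE lE; rewrite /decoder_cost.
pose y (z : V * V) := affine_map (diag_mx a) c z.1 + z.2.
have my : measurable_fun setT y.
  apply: measurable_cVD => //.
  exact: (measurableT_comp (measurable_affine _ _ _) measurable_fst).
pose cost (gd : V -> V) i (z : V * V) : R := (z.1 - gd (y z)) i ord0 ^+ 2.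
have mcost (gd : {mfun V >-> V}) i : measurable_fun setT (cost gd i).
  apply: measurable_funX; apply: measurable_fun_coord.
  by apply: measurable_cVB => //; exact: measurableT_comp.
under [X in ('E__[X] <= _)%E]eq_fun do
  rewrite -[sqnorm _]/(\sum_i cost _ i (M _, W _)).
under [X in (_ <= 'E__[X])%E]eq_fun do
  rewrite -[sqnorm _]/(\sum_i cost _ i (M _, W _)).
apply: (ge0_le_expectation_symmetrized
  (fun k => reflection (a ord0 k) (kappa ord0 k))
  (cost (affine_map (diag_mx kappa) l)) (cost gd') _ _ (mcost _) (mcost _)).
- by move=> k; exact: measurable_reflection.
- move=> k D mD; rewrite kE.
  by apply: normal_product_reflect => //; rewrite gt_eqF.
- by move=> k z; exact: sqr_ge0.
- by move=> k z; exact: sqr_ge0.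
move=> k z; rewrite /cost.
(* The reflection fixes y, so each decoder makes the same estimate at both points. *)
have -> : y (set_coord k (reflection (a ord0 k) (kappa ord0 k)) z) = y z.
  apply/colP => i; rewrite /y [LHS]mxE [RHS]mxE !affine_map_diagE /= !mxE.
  by case: eqP => // ->; rewrite /reflection /=; ring.
have subB (u v : V) : (u - v) k ord0 = u k ord0 - v k ord0 by rewrite !mxE.
rewrite !subB affine_map_diagE [X in kappa _ _ * X]mxE affine_map_diagE lE.
rewrite /set_coord /= mxE eqxx /reflection /=.
move: (z.1 k ord0) (z.2 k ord0) (gd' (y z) k ord0) (kappa ord0 k) (c k ord0)
  (a ord0 k) => m w v r e f.
rewrite -subr_ge0.
(* With [l] cancelling the encoder offset, u = r (f m + w) is the midpoint of m and its mirror
   image; the excess cost of an estimate v is twice its squared distance to u. *)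
rewrite [leRHS](_ : _ = 2 * (v - r * (f * m + w)) ^+ 2); last by ring.
by rewrite mulr_ge0// sqr_ge0.
Qed.

End responses.
End best_response.

(** * The scalar equilibrium and the conclusion *)

(* With r = kappa^2 + lambda, the two best-response equations force
   r^2 = lambda s^2 / t^2, and kappa^2 = r - lambda > 0 is the hypothesis. *)
Lemma scalar_equilibrium {R : realType} (s t lambda b : R) :
  0 < s -> 0 < t -> 0 < lambda -> lambda < s ^+ 2 / t ^+ 2 ->
  exists a kappa c l : R,
    [/\ a != 0, a = kappa / (kappa ^+ 2 + lambda),
        kappa = a * s ^+ 2 / (a ^+ 2 * s ^+ 2 + t ^+ 2),
        c = - (a * (b + l)) & l = - (kappa * c)].
Proof.
move=> s0 t0 lambda0 lt_st.
pose q := Num.sqrt lambda.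
have q0 : 0 < q by rewrite sqrtr_gt0.
have qE : q ^+ 2 = lambda by rewrite sqr_sqrtr// ltW.
pose r := q * s / t.
have r0 : 0 < r by rewrite divr_gt0// mulr_gt0.
(* After division by [q], this compares the square roots of the two sides of the hypothesis. *)
have lt_r : lambda < r.
  rewrite -qE /r expr2 -mulrA ltr_pM2l// -(@ltr_pXn2r _ 2) ?nnegrE ?ltW ?divr_gt0//.
  by rewrite qE expr_div_n.
pose kappa := Num.sqrt (r - lambda).
have kappa0 : 0 < kappa by rewrite sqrtr_gt0 subr_gt0.
have kappaE : kappa ^+ 2 = r - lambda by rewrite sqr_sqrtr// subr_ge0 ltW.
(* The offsets solve the linear system for [c] and [l], whose determinant 1 - a kappa equals
   [lambda / r]. *)
exists (kappa / r), kappa, (- (kappa * b / lambda)), (kappa ^+ 2 * b / lambda).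
(* The choice of [r] makes lambda s^2 / r^2 equal to t^2, which cancels. *)
have den : (kappa / r) ^+ 2 * s ^+ 2 + t ^+ 2 = s ^+ 2 / r.
  rewrite expr_div_n kappaE -qE /r; field.
  by rewrite !gt_eqF.
split.
- by rewrite mulf_neq0 ?invr_eq0 ?gt_eqF.
- by rewrite kappaE subrK.
- by rewrite den; field; rewrite !gt_eqF.
- by rewrite kappaE; field; rewrite !gt_eqF.
- by field; rewrite gt_eqF.
Qed.

(* All the ratios are nonnegative, so starting the maximum at 0 does not change
   it. *)
Theorem theoremV2 (R : realType) (d : measure_display) (T : measurableType d)
    (P : probability T R) (n : nat) (M W : {RV P >-> 'cV[R]_n})
    (sigma_m sigma_w : 'I_n -> R) (b : 'cV[R]_n) (lambda : R)
    (sigma_m_gt0 : forall i, 0 < sigma_m i)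
    (sigma_w_gt0 : forall i, 0 < sigma_w i)
    (gaussM : gaussian_vector M 0 (diag_mx (\row_i sigma_m i ^+ 2)))
    (gaussW : gaussian_vector W 0 (diag_mx (\row_i sigma_w i ^+ 2)))
    (indepMW : independent_RV M W)
    (lambda_gt0 : 0 < lambda)
    (lambda_lt : lambda <
       \big[Num.max/0]_(i < n) (sigma_m i ^+ 2 / sigma_w i ^+ 2)) :
  exists ge gd : {mfun 'cV[R]_n >-> 'cV[R]_n},
    nash_equilibrium M W b lambda ge gd /\ informative_affine ge gd.
Proof.
have [k lt_k] : exists k, lambda < sigma_m k ^+ 2 / sigma_w k ^+ 2.
  apply/existsP; apply: contraTT lambda_lt; rewrite negb_exists => /forallP le_k.
  (* The starting value 0 of the maximum is also at most [lambda]. *)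
  rewrite -leNgt; apply: bigmax_le => [|i _]; first exact: ltW.
  by rewrite leNgt; exact: le_k.
have [a0 [kappa0 [c0 [l0 [a0_neq0 aE kappaE cE lE]]]]] :=
  scalar_equilibrium _ _ _ (b k ord0) (sigma_m_gt0 k) (sigma_w_gt0 k)
    lambda_gt0 lt_k.
(* Off coordinate [k] all coefficients are 0, which solves the best-response equations whatever the
   variances and the bias are. *)
pose a : 'rV[R]_n := \row_i (if i == k then a0 else 0).
pose kappa : 'rV[R]_n := \row_i (if i == k then kappa0 else 0).
pose c : 'cV[R]_n := \col_i (if i == k then c0 else 0).
pose l : 'cV[R]_n := \col_i (if i == k then l0 else 0).
exists (affine_map (diag_mx a) c), (affine_map (diag_mx kappa) l).
split; last first.
  exists (diag_mx a), (diag_mx kappa), c, l; split => //.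
  apply: contra_neq a0_neq0 => /matrixP/(_ k k).
  by rewrite !mxE !eqxx mulr1n.
split => [ge'|gd'].
  apply: (encoder_best_response M W sigma_m sigma_w) => // i.
    by rewrite !mxE; case: eqP => // _; rewrite mul0r.
  by rewrite !mxE; case: eqVneq => [->|_]; rewrite ?mul0r ?oppr0.
apply: (decoder_best_response M W sigma_m sigma_w) => // i.
  by rewrite !mxE; case: eqVneq => [->|_]; rewrite ?mul0r.
by rewrite !mxE; case: eqP => _; rewrite ?mul0r ?oppr0.
Qed.
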